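(* Let $X_1,\dots,X_n$ be IID from a density $f$ on $\mathcal{X}\subseteq\mathbb{R}$, let $s\ge1$ be an integer, $x_0\in\mathcal{X}$, $M>0$ fixed, and let $f_0$ be a density that is $s$-times continuously differentiable at $x_0$. Let $$\mathcal{F}(s,f_0,x_0,M)=\{f\text{ a density},\ s\text{-times differentiable at }x_0,\ |f^{(s)}(x_0)|\le(1+M)|f_0^{(s)}(x_0)|\},$$ $$U(\delta;\varepsilon)=\Big\{f\in\mathcal{F}(s,f_0,x_0,M):\int_{|x-x_0|\le\varepsilon}|f^{(k)}(x)-f_0^{(k)}(x)|\,dx\le\delta\ \text{ for all }k\in\{0,1,\dots,s\}\Big\}.$$ Let $\delta_n=c_0n^{-r}$ with $c_0>0$ and $r\in[0,(2s+1)^{-1})$. Then for any $\varepsilon>0$, $$\liminf_{n\to\infty}\inf_T\sup_{f\in U(\delta_n;\varepsilon)}n^{2s/(2s+1)}\,\mathbb{E}_f|T(X)-f(x_0)|^2\ \ge\ \sup_K C(s,M,K)\,f_0(x_0)^{2s/(2s+1)}\,|f_0^{(s)}(x_0)|^{2/(2s+1)},$$ where $C(s,M,K)$ is a constant only depending on $s$, $M$ and $K$, the infimum is over measurable functions $T$ of $X=(X_1,\dots,X_n)$, and the supremum is over kernels $K$ satisfying the conditions in the context.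
   Context: $\mathbb{E}_f$ is expectation under $n$ IID observations from $f$. $f^{(k)}$ is the $k$th derivative. Conditions on a kernel $K$: (i) $K$ is uniformly bounded; (ii) $K$ is $s$-times differentiable with uniformly bounded $s$th derivative; (iii) $K$ integrates to one over its support; (iv) $\int_{-1}^1u^kK(u)\,du=0$ for all integers $k$ with $0<k<s$, and $\int_{-1}^1u^sK(u)\,du<\infty$. *)

(* Defs.v *)
From HB Require Import structures.
From mathcomp Require Import all_boot all_order all_algebra.
From mathcomp Require Import all_classical all_reals all_analysis.
From mathcomp Require Import measurable_realfun.
Import Order.TTheory GRing.Theory Num.Theory.
Import numFieldNormedType.Exports.

Set Implicit Arguments.
Unset Strict Implicit.
Unset Printing Implicit Defensive.

Local Open Scope ring_scope.
Local Open Scope classical_set_scope.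

Section n_times_derivable.
Context {R : realType}.

(* [derive1n] is total, so existence of the derivatives has to be said.  As
   usual, an (m+1)-th derivative at x requires the m-th one near x. *)
Fixpoint nderivable (n : nat) (f : R -> R) (x : R) : Prop :=
  if n is m.+1 then
    (\forall y \near x, nderivable m f y) /\ derivable (derive1n m f) x 1
  else True.

Definition ncontinuously_derivable (n : nat) (f : R -> R) (x : R) : Prop :=
  (\forall y \near x, nderivable n f y) /\ {for x, continuous (derive1n n f)}.

End n_times_derivable.

Section density.
Context {R : realType}.
Let mu := @lebesgue_measure R.

(* A density on X is a genuine function (not a class modulo null sets), since
   its values and derivatives at a point matter; it is extended by 0 off X. *)
Record density (X : set R) := Density {
  pdf :> R -> R ;
  measurable_pdf : measurable_fun [set: R] pdf ;
  pdf_ge0 : forall x, 0 <= pdf x ;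
  pdf_off : forall x, ~ X x -> pdf x = 0 ;
  integral_pdf : (\int[mu]_x (pdf x)%:E = 1)%E }.

Variables (X : set R) (f : density X).

Definition density_prob : set R -> \bar R :=
  fun A => (\int[mu]_(x in A) (f x)%:E)%E.

Let density_prob0 : density_prob set0 = 0%E.
Proof. by rewrite /density_prob integral_set0. Qed.

Let density_prob_ge0 A : (0 <= density_prob A)%E.
Proof. by apply: integral_ge0 => x _; rewrite lee_fin pdf_ge0. Qed.

Let density_prob_sigma_additive : semi_sigma_additive density_prob.
Proof.
move=> /= F mF tF mUF; rewrite /density_prob; apply: cvg_toP.
  apply: ereal_nondecreasing_is_cvgn => m n mn.
  apply: lee_sum_nneg_natr => // k _ _.
  by apply: integral_ge0 => /= x _; rewrite lee_fin pdf_ge0.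
rewrite ge0_integral_bigcup//=.
- by apply/measurable_EFinP/measurable_funTS; exact: measurable_pdf.
- by move=> x _; rewrite lee_fin pdf_ge0.
Qed.

HB.instance Definition _ := isMeasure.Build _ _ _ density_prob
  density_prob0 density_prob_ge0 density_prob_sigma_additive.

Let density_prob_setT : density_prob [set: R] = 1%E.
Proof. exact: integral_pdf. Qed.

HB.instance Definition _ :=
  @Measure_isProbability.Build _ _ R density_prob density_prob_setT.

End density.

Section iid.
Context d {T : measurableType d} {R : realType}.

Definition tuple_cons n (p : T * n.-tuple T) : n.+1.-tuple T :=
  [tuple of p.1 :: p.2].

Lemma measurable_tuple_cons n : measurable_fun setT (@tuple_cons n).
Proof. exact: measurable_cons. Qed.

HB.instance Definition _ n :=
  isMeasurableFun.Build _ _ _ _ (@tuple_cons n) (@measurable_tuple_cons n).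

(* The n-fold product of P, i.e. the joint law of n independent observations
   distributed as P (see [iid_prob_rect]). *)
Fixpoint iid_prob (P : probability T R) (n : nat) :
    probability (n.-tuple T) R :=
  if n is m.+1 then distribution (P \x iid_prob P m)%E (@tuple_cons m)
  else \d_([tuple] : 0.-tuple T).

Lemma iid_prob_rect (P : probability T R) n (A : 'I_n -> set T) :
  (forall i, measurable (A i)) ->
  iid_prob P n [set t | forall i, A i (tnth t i)] = (\prod_(i < n) P (A i))%E.
Proof.
elim: n A => [|n IHn] A mA.
  rewrite big_ord0 /= diracE mem_set//= => -[]//.
rewrite big_ord_recl -IHn// -product_measure1E//; last first.
  rewrite (_ : [set _ | _] = \big[setI/setT]_(i < n)
    ((fun t : n.-tuple T => tnth t i) @^-1` A (lift ord0 i))); last first.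
    apply/seteqP; split => t /=.
      by move=> h; rewrite -bigcap_seq => i _ /=; exact: h.
    by rewrite -bigcap_seq => h i; apply: (h i) => /=; rewrite mem_index_enum.
  apply: bigsetI_measurable => i _.
  by rewrite -[X in measurable X]setTI; exact: measurable_tnth.
rewrite /= /distribution /pushforward /=; congr (_ _).
apply/seteqP; split => -[x t] /=.
  move=> h; split => [|i]; first exact: (h ord0).
  by have := h (lift ord0 i); rewrite tnthS.
move=> [Ax At] i; case: (unliftP ord0 i) => [j|] ->; last by [].
by rewrite tnthS.
Qed.

End iid.

Section setting.
Context {R : realType}.
Let mu := @lebesgue_measure R.

(* [expect_iid f g] is E_f g(X_1, ..., X_n) for X_1, ..., X_n IID from f. *)
Definition expect_iid (X : set R) (f : density X) (n : nat)
    (g : n.-tuple R -> R) : \bar R :=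
  ('E_(iid_prob (density_prob f) n)[g])%E.

Definition smooth_densities (X : set R) (s : nat) (f0 : density X) (x0 M : R) :
    set (density X) :=
  [set f | nderivable s f x0 /\
           `|derive1n s f x0| <= (1 + M) * `|derive1n s f0 x0| ].

(* f0 is only assumed smooth near x0, so its k-th derivative may fail to exist
   in part of [x0 - eps, x0 + eps].  The derivatives of f have to exist almost
   everywhere where those of f0 do; where a derivative does not exist, [derive1n]
   takes a default value. *)
Definition neighbourhood (X : set R) (s : nat) (f0 : density X) (x0 M : R)
    (delta eps : R) : set (density X) :=
  let I := [set x : R | `|x - x0| <= eps] in
  [set f | smooth_densities s f0 x0 M f /\
    forall k : nat, (k <= s)%N ->
      [/\ {ae mu, forall x, I x -> nderivable k f0 x -> nderivable k f x},
          mu.-integrable I (fun x => (derive1n k f x - derive1n k f0 x)%:E) &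
          (\int[mu]_(x in I) `|derive1n k f x - derive1n k f0 x|%:E <= delta%:E)%E ] ].

(* K has mass one over its closed support, which is not forced to lie in [-1, 1];
   the moment conditions are on [-1, 1]. *)
Definition kernels (s : nat) : set (R -> R) :=
  let I := `[-1, 1]%classic : set R in
  [set K | [/\ exists B : R, forall u, `|K u| <= B,
      (forall u, nderivable s K u) /\
        exists B : R, forall u, `|derive1n s K u| <= B,
      (\int[mu]_(u in closure [set u | K u != 0%R]) (K u)%:E = 1)%E,
      forall k : nat, (0 < k < s)%N ->
        (\int[mu]_(u in I) (u ^+ k * K u)%:E = 0)%E &
      (\int[mu]_(u in I) (u ^+ s * K u)%:E < +oo)%E ] ].

End setting.

(* Main.v *)
From HB Require Import structures.
Require Import Defs.
From mathcomp Require Import all_boot all_order all_algebra.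
From mathcomp Require Import all_classical all_reals all_analysis.
From mathcomp Require Import measurable_realfun ring lra zify.
Import Order.TTheory GRing.Theory Num.Theory.
Import numFieldNormedType.Exports.

(** The proof is the two-point method of Le Cam.  Fix a function phi with compact
    support, phi(0) = 1, integral zero and s bounded derivatives, and perturb f0
    into f1(x) = f0(x) + a h^s phi((x - x0) / h).  Three requirements fix the
    amplitude a and the width h.

    - The s-th derivative of the perturbation is of order a, so taking a to be a
      small multiple of M |f0^(s)(x0)| respects the bound that defines F; the
      L^1 norms of its derivatives up to order s are of order a h, which is below
      c0 n^(-r) once h is of order n^(-1/(2s+1)), because r < 1/(2s+1)
      (scaled_bump_neighbourhood, near_bandwidth).

    - The chi-square divergence of f1 from f0 is of order a^2 h^(2s+1) / f0(x0).
      With h^(2s+1) a suitable multiple of f0(x0) / (a^2 n), the likelihood ratio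
      of n observations has second moment at most 2, so that no estimator tells
      f0 from f1 reliably (perturbation_risk).

    - Hence the sum of the two risks is at least a third of (f1(x0) - f0(x0))^2,
      that is of a^2 h^(2s) (two_point_risk).  Multiplied by n^(2s/(2s+1)) this is
      exactly a constant times the claimed expression in f0 (minimax_rate).

    The second-moment form of the two-point bound is convenient because it
    follows by integrating one polynomial inequality in the likelihood ratio
    (weighted_sq_dist_ge), and because the second moment is multiplicative over
    independent observations (iid_likelihood_ratio, integral_iid_likelihood).

    The profile phi is the derivative of a polynomial times a truncated power of
    1 - u^2; the family of such products is closed under differentiation, so no
    smooth cut-off is called for, and the primitive makes the integral vanish
    (exists_perturbation_profile).  As f0 is smooth only near x0, compactness of
    the support matters: the perturbation adds exactly its own derivatives to
    those of f0, wherever the latter exist or not (derive1n_perturb).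

    The constant so obtained depends on s and M only, hence bounds the supremum
    over kernels. *)

Set Implicit Arguments.
Unset Strict Implicit.
Unset Printing Implicit Defensive.

Local Open Scope ring_scope.
Local Open Scope classical_set_scope.

(** * The two-point inequality *)

(** Whatever value t is reported, a weighted sum of squared distances to the two
    candidates is at least (b - a)^2 L / (1 + L).  Replacing 1 / (1 + L) by its
    tangent 5/9 - L/9 at L = 2 gives a lower bound that is linear in L and L^2, so
    that two moments of L suffice to integrate it. *)
Lemma weighted_sq_dist_ge (R : realFieldType) (t a b L : R) : 0 <= L ->
  5 / 9 * (b - a) ^+ 2 * L
  <= (t - a) ^+ 2 + L * (t - b) ^+ 2 + 9^-1 * (b - a) ^+ 2 * L ^+ 2.
Proof.
move=> L0; have L1 : 0 < 1 + L by rewrite ltr_pwDl.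
rewrite -subr_ge0 -(pmulr_rge0 _ L1).
(* completing the square in t *)
rewrite [leRHS](_ : _ = ((1 + L) * (t - a) - L * (b - a)) ^+ 2
  + 9^-1 * L * ((b - a) * (L - 2)) ^+ 2); last by field.
by rewrite addr_ge0 ?sqr_ge0// mulr_ge0 ?sqr_ge0// mulr_ge0.
Qed.

Section two_point.
Context d {T : measurableType d} {R : realType}.
Local Open Scope ereal_scope.

Definition likelihood_ratio (P Q : probability T R) (l : T -> R) :=
  [/\ measurable_fun setT l, forall x, (0 <= l x)%R &
      forall h : T -> \bar R, measurable_fun setT h -> (forall x, 0 <= h x) ->
        \int[Q]_x h x = \int[P]_x ((l x)%:E * h x)].

(** Le Cam's two-point method with the second moment of the likelihood ratio in
    place of the total variation distance.  Under P the ratio l has mean one, and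
    its second moment is the mean of l under Q; when this is at most 2, the
    pointwise inequality above integrates to (5/9 - 2/9) (b - a)^2. *)
Lemma two_point_risk (P Q : probability T R) (l : T -> R) (U : T -> R) (a b : R) :
  likelihood_ratio P Q l -> \int[Q]_x (l x)%:E <= 2%:E ->
  measurable_fun setT U ->
  (3^-1 * (b - a) ^+ 2)%:E
  <= \int[P]_x ((U x - a) ^+ 2)%:E + \int[Q]_x ((U x - b) ^+ 2)%:E.
Proof.
move=> [ml l0 PQ] l2 mU; set w := ((b - a) ^+ 2)%R.
have w0 : (0 <= w)%R by exact: sqr_ge0.
have mUa c : measurable_fun setT (fun x => ((U x - c) ^+ 2)%:E).
  by apply/measurable_EFinP/measurable_funX/measurable_funB.
have Ua0 c x : 0 <= ((U x - c) ^+ 2)%:E by rewrite lee_fin sqr_ge0.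
have mlE : measurable_fun setT (EFin \o l) by exact/measurable_EFinP.
have l1 : \int[P]_x (l x)%:E = 1.
  have Q1 : \int[Q]_x cst 1 x = 1.
    by rewrite integral_cst// mul1e; exact: probability_setT.
  rewrite -Q1 (PQ (cst 1) (measurable_cst _) (fun=> lee01)).
  by apply: eq_integral => x _; rewrite mule1.
have lU0 x : 0 <= (l x)%:E * ((U x - b) ^+ 2)%:E.
  by rewrite -EFinM lee_fin mulr_ge0// sqr_ge0.
have mlU : measurable_fun setT (fun x => (l x)%:E * ((U x - b) ^+ 2)%:E).
  exact: emeasurable_funM.
have ll0 x : 0 <= (l x)%:E * (l x)%:E by rewrite -EFinM lee_fin mulr_ge0.
have mll : measurable_fun setT (fun x => (l x)%:E * (l x)%:E).
  exact: emeasurable_funM.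
have w9 : (0 <= 9^-1 * w)%R by rewrite mulr_ge0.
have wl0 x : 0 <= (9^-1 * w)%:E * ((l x)%:E * (l x)%:E).
  by apply: mule_ge0 => //; rewrite lee_fin.
have mwl : measurable_fun setT (fun x => (9^-1 * w)%:E * ((l x)%:E * (l x)%:E)).
  exact: measurable_funeM.
have main : \int[P]_x ((5 / 9 * w)%:E * (l x)%:E)
    <= \int[P]_x (((U x - a) ^+ 2)%:E + (l x)%:E * ((U x - b) ^+ 2)%:E
        + (9^-1 * w)%:E * ((l x)%:E * (l x)%:E)).
  apply: ge0_le_integral => //.
  - by move=> x _; rewrite -EFinM lee_fin mulr_ge0// mulr_ge0// divr_ge0.
  - exact: measurable_funeM.
  - by apply: emeasurable_funD => //; exact: emeasurable_funD.
  - move=> x _; rewrite -!EFinM -!EFinD lee_fin -expr2.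
    exact: weighted_sq_dist_ge.
move: main; rewrite ge0_integralZl_EFin//; last 2 first.
- by move=> x _; rewrite lee_fin.
- by rewrite mulr_ge0// divr_ge0.
rewrite l1 mule1 ge0_integralD//; last 2 first.
- by move=> x _; exact: adde_ge0.
- exact: emeasurable_funD.
rewrite ge0_integralD// ge0_integralZl_EFin//.
(* both remaining integrals against l under P are integrals under Q *)
rewrite -PQ// -PQ//.
move=> main; set X := \int[P]_x _ + _.
have : (5 / 9 * w)%:E <= X + (9^-1 * w * 2)%:E.
  apply: le_trans main _; rewrite leeD2l// [leRHS]EFinM lee_wpmul2l//.
case: X {main} => [x| |]; [|by move=> _; rewrite leey|by rewrite addNye leeNy_eq].
by rewrite -EFinD !lee_fin; lra.
Qed.

End two_point.

(** * Likelihood ratios of independent samples *)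

Section iid.
Context d {T : measurableType d} {R : realType}.
Local Open Scope ereal_scope.
Implicit Types P Q : probability T R.

Lemma integral_iidS P n (F : n.+1.-tuple T -> \bar R) :
  measurable_fun setT F -> (forall t, 0 <= F t) ->
  \int[iid_prob P n.+1]_t F t
  = \int[P]_x \int[iid_prob P n]_t F (tuple_cons (x, t)).
Proof.
move=> mF F0 /=.
rewrite ge0_integral_distribution//.
rewrite fubini_tonelli1//=.
by apply: measurableT_comp.
Qed.

Definition iid_likelihood (l : T -> R) n (t : n.-tuple T) : R :=
  (\prod_(i < n) l (tnth t i))%R.

Lemma measurable_iid_likelihood (l : T -> R) n :
  measurable_fun setT l -> measurable_fun setT (@iid_likelihood l n).
Proof.
move=> ml; apply: measurable_prod => i _.
by apply: measurableT_comp => //; exact: measurable_tnth.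
Qed.

Lemma iid_likelihood_ge0 (l : T -> R) n (t : n.-tuple T) :
  (forall x, (0 <= l x)%R) -> (0 <= iid_likelihood l t)%R.
Proof. by move=> l0; exact: prodr_ge0. Qed.

Lemma iid_likelihoodS (l : T -> R) n (x : T) (t : n.-tuple T) :
  (iid_likelihood l (tuple_cons (x, t)) = l x * iid_likelihood l t)%R.
Proof.
by rewrite /iid_likelihood big_ord_recl; congr (_ * _)%R; apply: eq_bigr => i _;
  rewrite tnthS.
Qed.

Lemma measurable_tuple_cons_slice n (x : T) :
  measurable_fun setT (fun t : n.-tuple T => tuple_cons (x, t)).
Proof. by apply: (@measurable_cons _ _ _ _ (cst x) n id). Qed.

(** Tonelli's theorem peels off one observation at a time: the inner integral is
    handled by induction and the outer one by the ratio of a single observation. *)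
Lemma iid_likelihood_ratio P Q (l : T -> R) n :
  likelihood_ratio P Q l ->
  likelihood_ratio (iid_prob P n) (iid_prob Q n) (@iid_likelihood l n).
Proof.
move=> [ml l0 PQ]; split; first exact: measurable_iid_likelihood.
  by move=> t; exact: iid_likelihood_ge0.
elim: n => [|n IHn] F mF F0.
  rewrite /= !integral_dirac//; first by rewrite /iid_likelihood big_ord0 !mul1e.
  apply: emeasurable_funM => //; apply/measurable_EFinP.
  exact: measurable_iid_likelihood.
have mL := @measurable_iid_likelihood l n.+1 ml.
have L0 t := @iid_likelihood_ge0 l n.+1 t l0.
rewrite !integral_iidS//; last 2 first.
- by apply: emeasurable_funM => //; exact/measurable_EFinP.
- by move=> t; rewrite mule_ge0 ?lee_fin//.
have mFx x : measurable_fun setT (fun t : n.-tuple T => F (tuple_cons (x, t))).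
  by apply: measurableT_comp => //; exact: measurable_tuple_cons_slice.
have mLn : measurable_fun setT (EFin \o @iid_likelihood l n).
  by apply/measurable_EFinP; exact: measurable_iid_likelihood.
transitivity (\int[Q]_x
    \int[iid_prob P n]_t ((iid_likelihood l t)%:E * F (tuple_cons (x, t)))).
  by apply: eq_integral => x _; rewrite IHn.
rewrite PQ; last 2 first.
- apply: (@measurable_fun_fubini_tonelli_F _ _ _ _ _ (iid_prob P n)
    (fun p => (iid_likelihood l p.2)%:E * F (tuple_cons p))).
    apply: emeasurable_funM; last by apply: measurableT_comp.
    exact: (measurableT_comp mLn).
  by move=> p; apply: mule_ge0 => //; exact: iid_likelihood_ge0.
- move=> x; apply: integral_ge0 => t _.
  by apply: mule_ge0 => //; exact: iid_likelihood_ge0.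
apply: eq_integral => x _.
rewrite -ge0_integralZl_EFin//; last 2 first.
- by move=> t _; apply: mule_ge0 => //; exact: iid_likelihood_ge0.
- exact: emeasurable_funM.
by apply: eq_integral => t _; rewrite iid_likelihoodS EFinM muleA.
Qed.

Lemma integral_iid_likelihood P (l : T -> R) n :
  measurable_fun setT l -> (forall x, (0 <= l x)%R) ->
  \int[iid_prob P n]_t (iid_likelihood l t)%:E = (\int[P]_x (l x)%:E) ^+ n.
Proof.
move=> ml l0; elim: n => [|n IHn].
  rewrite /= integral_dirac//; first by rewrite diracT mul1e /iid_likelihood big_ord0.
  by apply/measurable_EFinP; exact: measurable_iid_likelihood.
have mlE : measurable_fun setT (EFin \o l) by exact/measurable_EFinP.
rewrite integral_iidS; last 2 first.
- by apply/measurable_EFinP; exact: measurable_iid_likelihood.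
- by move=> t; rewrite lee_fin iid_likelihood_ge0.
rewrite expeS -IHn -ge0_integralZr//; last 2 first.
- by move=> x _; rewrite lee_fin.
- by apply: integral_ge0 => t _; rewrite lee_fin iid_likelihood_ge0.
apply: eq_integral => x _; rewrite -ge0_integralZl_EFin//.
- by apply: eq_integral => t _; rewrite iid_likelihoodS EFinM.
- by move=> t _; rewrite lee_fin iid_likelihood_ge0.
- by apply/measurable_EFinP; exact: measurable_iid_likelihood.
Qed.

End iid.

(** * Change of density *)

Section density_change.
Context {R : realType} (X : set R).
Let mu := @lebesgue_measure R.
Local Open Scope ereal_scope.

(** Lebesgue measure and the laws of densities are set on two copies of the
    Borel space of the line; the identity transports the latter to the former. *)
Let idTR : R -> measurableTypeR R := idfun.

#[local] HB.instance Definition _ :=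
  @isMeasurableFun.Build _ _ _ _ idTR (@measurable_id _ _ setT).

Let borel_prob (f : density X) : probability (measurableTypeR R) R :=
  distribution (density_prob f) idTR.

Lemma density_prob_dominated (f : density X) : borel_prob f `<< mu.
Proof.
apply/null_content_dominatesP => A mA muA; apply: null_set_integral => //.
by apply/measurable_EFinP/measurable_funTS; exact: measurable_pdf.
Qed.

Lemma integrable_pdf (f : density X) : mu.-integrable setT (EFin \o f).
Proof.
apply/integrableP; split; first by apply/measurable_EFinP; exact: measurable_pdf.
under eq_integral do rewrite /= ger0_norm ?pdf_ge0//.
by rewrite integral_pdf ltry.
Qed.

(** The density is a version of the Radon-Nikodym derivative of the law, so the
    change of variables for that derivative applies. *)
Lemma integral_density_prob (f : density X) (h : R -> \bar R) :
  measurable_fun setT h -> (forall x, 0 <= h x) ->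
  \int[density_prob f]_x h x = \int[mu]_x (h x * (f x)%:E).
Proof.
move=> mh h0.
have dom := density_prob_dominated f.
transitivity (\int[borel_prob f]_x h x).
  by rewrite ge0_integral_distribution.
rewrite -(Radon_Nikodym_SigmaFinite.change_of_variables dom h0)//.
have irn := Radon_Nikodym_SigmaFinite.f_integrable dom.
have mrn := measurable_int _ irn.
have mf : measurable_fun setT (EFin \o f).
  by apply/measurable_EFinP; exact: measurable_pdf.
apply: ae_eq_integral => //; [exact: emeasurable_funM..|].
apply: ae_eqe_mul2l; apply: integral_ae_eq => // A _ mA.
by rewrite -Radon_Nikodym_SigmaFinite.f_integral.
Qed.

Lemma density_likelihood_ratio (f0 f1 : density X) (l : R -> R) :
  measurable_fun setT l -> (forall x, (0 <= l x)%R) ->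
  (forall x, f1 x = l x * f0 x)%R ->
  likelihood_ratio (density_prob f0) (density_prob f1) l.
Proof.
move=> ml l0 f10; split => // h mh h0.
rewrite !integral_density_prob//; last 2 first.
- by apply: emeasurable_funM => //; exact/measurable_EFinP.
- by move=> x; apply: mule_ge0 => //; rewrite lee_fin.
by apply: eq_integral => x _; rewrite f10 EFinM muleA (muleC (h x)).
Qed.

End density_change.

(** * Iterated derivatives of local perturbations *)

Section nderivable.
Context {R : realType}.
Implicit Types (f g : R -> R) (U : set R).

Lemma nderivableW n k f x : (k <= n)%N -> nderivable n f x -> nderivable k f x.
Proof.
elim: n x => [|n IHn] x; first by rewrite leqn0 => /eqP ->.
rewrite leq_eqVlt => /predU1P[->//|]; rewrite ltnS => kn [fx _].
by apply: IHn => //; exact: nbhs_singleton fx.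
Qed.

Lemma nderivable_derivable n k f x : (k < n)%N -> nderivable n f x ->
  derivable (derive1n k f) x 1.
Proof. by move=> kn /(nderivableW kn)[]. Qed.

Lemma derive1n_eq_open U f g k : open U -> {in U, f =1 g} ->
  {in U, derive1n k f =1 derive1n k g} /\
  (forall x, U x -> nderivable k f x -> nderivable k g x).
Proof.
move=> oU fg; elim: k => [|k [IHe IHd]]; first by split.
have nearE x : U x -> \forall y \near x, derive1n k f y = derive1n k g y.
  move=> Ux; near=> y; apply: IHe; rewrite inE; near: y.
  exact: open_nbhs_nbhs.
split=> x.
  by rewrite inE => Ux; rewrite !derive1nS !derive1E; apply: near_eq_derive; exact: nearE.
move=> Ux [ndf df]; split; last exact: near_eq_derivable (nearE _ Ux) df.
near=> y; apply: IHd; first by near: y; exact: open_nbhs_nbhs.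
by near: y.
Unshelve. all: by end_near. Qed.

Lemma derive1nD_open U n f g : open U ->
  (forall x, U x -> nderivable n f x) -> (forall x, nderivable n g x) ->
  forall k, (k <= n)%N -> forall x, U x ->
    nderivable k (f \+ g) x /\
    derive1n k (f \+ g) x = derive1n k f x + derive1n k g x.
Proof.
move=> oU nf ng; elim=> [|k IHk] kn x Ux; first by [].
have nearE : \forall y \near x, derive1n k f y + derive1n k g y = derive1n k (f \+ g) y.
  near=> y; apply/esym/(IHk (ltnW kn) y _).2; near: y; exact: open_nbhs_nbhs.
have df := nderivable_derivable kn (nf _ Ux).
have dg := nderivable_derivable kn (ng x).
split.
  split; last by apply: near_eq_derivable nearE _; exact: derivableD.
  near=> y; apply: (IHk (ltnW kn) y _).1; near: y; exact: open_nbhs_nbhs.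
by rewrite !derive1nS !derive1E -(near_eq_derive _ nearE) deriveD.
Unshelve. all: by end_near. Qed.

Lemma derive1n_cst0 k : derive1n k (cst 0 : R -> R) = cst 0.
Proof.
elim: k => // k IHk; rewrite derive1nS IHk; apply/funext => x.
by rewrite derive1E derive_cst.
Qed.

(** Two open sets cover the line: U, where f is smooth and differentiation is
    additive, and V, where f + g and f agree near every point.  So f^(k) changes by
    exactly g^(k) everywhere, even where f^(k) only has a default value. *)
Lemma derive1n_perturb U V n f g : open U -> open V -> U `|` V = setT ->
  (forall x, U x -> nderivable n f x) -> (forall x, nderivable n g x) ->
  (forall x, V x -> g x = 0) ->
  forall k, (k <= n)%N -> forall x,
    (nderivable k f x -> nderivable k (f \+ g) x) /\
    derive1n k (f \+ g) x = derive1n k f x + derive1n k g x.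
Proof.
move=> oU oV UV nf ng gV k kn x.
have [Ux|Vx] : (U `|` V) x by rewrite UV.
  by have [? ?] := derive1nD_open oU nf ng kn Ux.
have fV : {in V, f =1 f \+ g} by move=> y /[!inE] /gV /= ->; rewrite addr0.
have g0 : {in V, g =1 cst 0} by move=> y /[!inE] /gV.
have [fE fd] := derive1n_eq_open k oV fV.
have [gE _] := derive1n_eq_open k oV g0.
split; first exact: fd.
by rewrite -fE ?inE// gE ?inE// derive1n_cst0 addr0.
Qed.

Lemma derive1n_scale n (F : R -> R) (c x0 h : R) :
  (forall x, nderivable n F x) ->
  let g x := c * F ((x - x0) / h) in
  forall k, (k <= n)%N ->
    (forall x, nderivable k g x) /\
    derive1n k g = (fun x => c * h^-1 ^+ k * derive1n k F ((x - x0) / h)).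
Proof.
move=> nF g; elim=> [|k IHk] kn.
  by split => //; apply/funext => x; rewrite expr0 mulr1.
have [ng gE] := IHk (ltnW kn).
have dg (x : R) : is_derive x (1 : R) (derive1n k g : R -> R)
    (c * h^-1 ^+ k.+1 * derive1n k.+1 F ((x - x0) / h)).
  rewrite gE; have dF := nderivable_derivable kn (nF ((x - x0) / h)).
  have dL : is_derive x (1 : R) (fun y : R => (y - x0) / h) h^-1.
    rewrite (_ : (fun _ => _) = h^-1 \*: (id - cst x0)); last first.
      by apply/funext => y; rewrite /= mulrC.
    apply: is_derive_eq.
    by rewrite subr0 /GRing.scale /= mulr1.
  have dFx : is_derive ((x - x0) / h) (1 : R) (derive1n k F)
      (derive1n k.+1 F ((x - x0) / h)).
    by apply: DeriveDef => //; rewrite derive1nS derive1E.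
  have dC := @is_derive1_comp _ _ (fun y : R => (y - x0) / h) _ _ _ dFx dL.
  have := @is_deriveZ _ _ _ _ (c * h^-1 ^+ k) _ _ _ dC.
  by move=> H; apply: is_derive_eq; rewrite /GRing.scale/= exprSr; ring.
split; last by apply/funext => x; have [_ <-] := dg x; rewrite derive1nS derive1E.
move=> x; split; last by case: (dg x).
by near=> y; exact: ng.
Unshelve. all: by end_near. Qed.

End nderivable.

(** * A compactly supported profile with integral zero *)

Section bump.
Context {R : realType}.
Implicit Types (p : {poly R}).

(** The truncated power (1 - u^2)_+^m carries the smoothness and the support; the
    polynomial factor makes the family stable under differentiation. *)
Definition bump m p (u : R) : R := Num.max 0 (1 - u ^+ 2) ^+ m * p.[u].

Lemma is_derive_exprn n (x : R) :
  is_derive x (1 : R) (fun y : R => y ^+ n) (n%:R * x ^+ n.-1).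
Proof.
apply: DeriveDef; first exact: exprn_derivable.
by rewrite exp_derive /GRing.scale/= mulr1.
Qed.

Lemma continuous_max0X m : continuous (fun w : R => Num.max 0 w ^+ m).
Proof.
move=> w; apply: (@cvg_comp _ _ _ (fun w : R => Num.max 0 w) (fun w : R => w ^+ m)).
  apply: (@continuous_max _ _ (cst 0) id); first exact: cvg_cst.
  exact: cvg_id.
exact: exprn_continuous.
Qed.

(** Only the origin needs an argument: there the difference quotient is the next
    lower truncated power, which vanishes continuously. *)
Lemma is_derive_max0X m (v : R) :
  is_derive v 1 (fun w : R => Num.max 0 w ^+ m.+2) (m.+2%:R * Num.max 0 v ^+ m.+1).
Proof.
have [v0|v0|v0] := ltgtP v 0.
- rewrite expr0n mulr0.
  apply: (near_eq_is_derive _ (is_derive_cst 0 v 1)).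
  near=> w; rewrite max_l ?expr0n//; apply/ltW; near: w.
  exact: lt_nbhsl.
- apply: (near_eq_is_derive (f := fun w : R => w ^+ m.+2)).
    near=> w; rewrite max_r//; apply/ltW; near: w.
    exact: lt_nbhsr.
  exact: is_derive_exprn.
- rewrite v0 expr0n mulr0.
  pose q (h : R) : R :=
    h^-1 *: (Num.max 0 (h *: (1 : R) + 0 : R) ^+ m.+2 - Num.max 0 (0 : R) ^+ m.+2).
  suff H : q h @[h --> 0^'] --> (0 : R).
    apply: DeriveDef; first by apply/cvg_ex; exists 0; exact: H.
    exact: (cvg_lim _ H).
  have H : Num.max 0 h ^+ m.+1 @[h --> (0:R)^'] --> (0 : R).
    have := @continuous_max0X m.+1 0.
    rewrite /continuous_at maxxx expr0n; apply: cvg_trans.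
    exact: cvg_app (@nbhs_dnbhs _ 0).
  apply: cvg_trans H; apply: near_eq_cvg; near=> h.
  have h0 : h != 0 by near: h; exact: nbhs_dnbhs_neq.
  rewrite /q maxxx expr0n subr0 addr0 /GRing.scale/= mulr1 [in RHS]exprS.
  by have [hp|hn] := leP 0 h; [rewrite mulKf|rewrite expr0n mul0r mulr0].
Unshelve. all: by end_near. Qed.

(** The polynomial factor of the derivative, once a factor (1 - u^2)_+ has been
    taken out. *)
Definition bump_deriv m p : {poly R} :=
  (1 - 'X ^+ 2) * p^`() - (m%:R * 2) *: ('X * p).

Lemma is_derive_bump m p (u : R) :
  is_derive u 1 (bump m.+2 p) (bump m.+1 (bump_deriv m.+2 p) u).
Proof.
have dQ : is_derive u (1 : R) (fun u : R => 1 - u ^+ 2) (- (2 * u)).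
  rewrite (_ : (fun _ => _) = cst 1 - (fun u : R => u ^+ 2))//.
  have dX := is_derive_exprn 2 u.
  by apply: is_derive_eq; rewrite sub0r expr1.
have dP : is_derive u (1 : R) (horner p) (p^`()).[u] by exact: is_derive_poly.
have dM := @is_derive1_comp _ _ (fun u : R => 1 - u ^+ 2) _ _ _
  (is_derive_max0X m (1 - u ^+ 2)) dQ.
have := is_deriveM dM dP.
move=> H; apply: (is_derive_eq H).
rewrite /bump /bump_deriv /GRing.scale/= -polyC1.
rewrite !(hornerD, hornerN, hornerM, hornerZ, hornerX, hornerXn, hornerC).
(* one factor may be untruncated, since the others vanish outside [-1, 1] *)
have E : Num.max 0 (1 - u ^+ 2) ^+ m.+1 * (1 - u ^+ 2) = Num.max 0 (1 - u ^+ 2) ^+ m.+2.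
  rewrite [RHS]exprSr; have [//|//] := leP 0 (1 - u ^+ 2).
  by rewrite expr0n !mul0r.
rewrite -E; ring.
Qed.

Lemma derive1n_bump m p k : (k < m)%N ->
  (forall u, nderivable k (bump m p) u) /\
  exists q, derive1n k (bump m p) = bump (m - k) q.
Proof.
elim: k => [|k IHk] km; first by split => //; exists p; rewrite subn0.
have [nb [q bE]] := IHk (ltnW km).
have [j mE] : exists j, (m - k)%N = j.+2 by exists (m - k).-2; lia.
have dq (u : R) : is_derive u (1 : R) (derive1n k (bump m p))
    (bump j.+1 (bump_deriv j.+2 q) u).
  by rewrite bE mE; exact: is_derive_bump.
split.
  move=> u; split; last by case: (dq u).
  by near=> y; exact: nb.
exists (bump_deriv j.+2 q); apply/funext => u.
by rewrite derive1nS derive1E (_ : (m - k.+1)%N = j.+1); [case: (dq u)|lia].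
Unshelve. all: by end_near. Qed.

Lemma continuous_bump m p : continuous (bump m p).
Proof.
move=> u; apply: cvgM; last exact: continuous_horner.
apply: (@cvg_comp _ _ _ (fun u : R => 1 - u ^+ 2) (fun w : R => Num.max 0 w ^+ m)).
  by apply: cvgB; [exact: cvg_cst|exact: exprn_continuous].
exact: continuous_max0X.
Qed.

Lemma bump_outside m p (u : R) : 1 <= `|u| -> bump m.+1 p u = 0.
Proof.
move=> u1; rewrite /bump max_l ?expr0n ?mul0r//.
by rewrite subr_le0 -real_normK ?num_real// expr_ge1.
Qed.

Lemma bump_bounded m p : exists2 B, 0 <= B & forall u, `|bump m.+1 p u| <= B.
Proof.
have cb : {within `[-1, 1], continuous (fun u => `|bump m.+1 p u|)}.
  apply: continuous_subspaceT => u.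
  by apply: cvg_norm; exact: continuous_bump.
have [|c _ cmax] := @EVT_max R _ (-1) 1 _ cb; first by lra.
exists `|bump m.+1 p c| => // u.
have [u1|u1] := leP 1 `|u|; first by rewrite bump_outside// normr0.
by apply: cmax; rewrite in_itv/= -ler_norml ltW.
Qed.

Lemma derive1n_bump_bounded s p : exists2 B, 1 <= B &
  forall k u, (k <= s)%N -> `|derive1n k (bump s.+1 p) u| <= B.
Proof.
suff H n : (n <= s.+1)%N -> exists2 B, 1 <= B &
    forall k u, (k < n)%N -> `|derive1n k (bump s.+1 p) u| <= B.
  by have [B B1 HB] := H s.+1 (leqnn _); exists B.
elim: n => [|n IHn] ns; first by exists 1.
have [B B1 HB] := IHn (ltnW ns).
have [_ [q qE]] := derive1n_bump p ns.
have [j jE] : exists j, (s.+1 - n)%N = j.+1 by exists (s.+1 - n).-1; lia.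
have [B' B'0 HB'] := bump_bounded j q.
exists (B + B'); first by rewrite ler_wpDr.
move=> k u; rewrite ltnS leq_eqVlt => /predU1P[->|kn].
  by rewrite qE jE (le_trans (HB' u))// lerDr (le_trans _ B1).
by rewrite (le_trans (HB _ _ kn))// lerDl.
Qed.

(** The shape of the perturbation that separates the two hypotheses.  It is given
    through a primitive Phi with equal values at -1 and 1: its integral then
    vanishes at every scale, by the fundamental theorem of calculus. *)
Definition perturbation_profile (s : nat) (B : R) (phi : R -> R) : Prop :=
  [/\ phi 0 = 1,
      forall u, 1 <= `|u| -> phi u = 0,
      exists2 Phi : R -> R, forall u : R, is_derive u (1 : R) Phi (phi u)
        & Phi 1 = Phi (-1),
      forall u, nderivable s phi u &
      forall k, (k <= s)%N -> continuous (derive1n k phi) /\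
                           forall u, `|derive1n k phi u| <= B].

(** The derivative of u (1 - u^2)_+^(s+2) has value one at the origin and, being
    the derivative of a function that vanishes at -1 and 1, integral zero.  Its
    s-th derivative still carries one truncated factor, so it is continuous. *)
Lemma exists_perturbation_profile s :
  exists2 B : R, 1 <= B & exists phi, perturbation_profile s B phi.
Proof.
have [B B1 HB] := derive1n_bump_bounded s (bump_deriv s.+2 'X).
exists B => //; exists (bump s.+1 (bump_deriv s.+2 'X)); split.
- rewrite /bump expr0n subr0 max_r// expr1n mul1r /bump_deriv derivX mulr1.
  rewrite hornerD hornerN hornerZ hornerM hornerX mul0r mulr0 subr0.
  by rewrite !hornerE expr0n subr0.
- by move=> u u1; rewrite bump_outside.
- exists (bump s.+2 'X); first by move=> u; exact: is_derive_bump.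
  by rewrite !bump_outside// ?normrN normr1.
- by move=> u; have [] := derive1n_bump (bump_deriv s.+2 'X) (ltnSn s).
- move=> k ks; split; last by move=> u; exact: HB.
  have [_ [q ->]] := derive1n_bump (bump_deriv s.+2 'X) (ks : (k < s.+1)%N).
  exact: continuous_bump.
Qed.

End bump.

(** * Integrals of functions supported in a short interval *)

Section perturbation.
Context {R : realType}.
Let mu := @lebesgue_measure R.
Implicit Types (g : R -> R) (h b : R).

Lemma integral_supported_le g (x0 : R) h b : 0 <= b -> 0 < h -> continuous g ->
  (forall x, `|g x| <= b) -> (forall x, h < `|x - x0| -> g x = 0) ->
  (\int[mu]_x `|g x|%:E <= (b * (2 * h))%:E)%E.
Proof.
move=> b0 h0 cg gb gs.
have mJ : measurable (`[x0 - h, x0 + h]%classic : set (measurableTypeR R)).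
  exact: measurable_itv.
have muJ : (mu `[(x0 - h)%R, (x0 + h)%R] = (2 * h)%:E)%E.
  rewrite /mu lebesgue_measure_itv/= lte_fin ltrBlDr -addrA ltrDl addr_gt0//.
  by rewrite -EFinD; congr (_ %:E); ring.
have -> : ((b * (2 * h))%:E = \int[mu]_x (b * \1_(`[x0 - h, x0 + h]%classic) x)%:E)%E.
  under eq_integral do rewrite EFinM.
  rewrite ge0_integralZl_EFin//; last by apply/measurable_EFinP; exact: measurable_indic.
  rewrite integral_indic// setIT.
  transitivity (b%:E * mu `[(x0 - h)%R, (x0 + h)%R])%E => //.
  by rewrite muJ.
apply: ge0_le_integral => //.
- apply/measurable_EFinP; apply: measurableT_comp => //.
  exact: continuous_measurable_fun.
- by apply/measurable_EFinP; apply: measurable_funM => //; exact: measurable_indic.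
- move=> x _; rewrite lee_fin indicE.
  have [xJ|xJ] := boolP (x \in `[x0 - h, x0 + h]%classic).
    by rewrite mulr1 gb.
  rewrite gs ?normr0 ?mulr0//.
  rewrite ltNge; apply: contra xJ => xJ; rewrite inE/= in_itv/=.
  by rewrite -ler_distlC distrC.
Qed.

Lemma integrable_supported g (x0 : R) h b : 0 <= b -> 0 < h -> continuous g ->
  (forall x, `|g x| <= b) -> (forall x, h < `|x - x0| -> g x = 0) ->
  mu.-integrable setT (EFin \o g).
Proof.
move=> b0 h0 cg gb gs; apply/integrableP; split.
  by apply/measurable_EFinP; exact: continuous_measurable_fun.
apply: le_lt_trans (ltry (b * (2 * h))).
exact: (integral_supported_le b0 h0 cg gb gs).
Qed.

Lemma integral_supported_derivative g (G : R -> R) (x0 : R) h : 0 < h -> continuous g ->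
  (forall x, h < `|x - x0| -> g x = 0) ->
  (forall x : R, is_derive x (1 : R) G (g x)) -> G (x0 + h) = G (x0 - h) ->
  (\int[mu]_x (g x)%:E = 0)%E.
Proof.
move=> h0 cg gs dG GE.
have cG : continuous G.
  by move=> x; apply/differentiable_continuous/derivable1_diffP; case: (dG x).
transitivity (\int[mu]_(x in `[(x0 - h)%R, (x0 + h)%R]) (g x)%:E)%E.
  rewrite [RHS]integral_mkcond; apply: eq_integral => x _.
  rewrite patchE; case: ifPn => // xJ; rewrite gs//.
  rewrite ltNge; apply: contra xJ => xJ; rewrite inE/= in_itv/=.
  by rewrite -ler_distlC distrC.
rewrite (@continuous_FTC2 _ g G) ?GE ?subee//.
- by rewrite ltrBlDr -addrA ltrDl addr_gt0.
- exact: continuous_subspaceT.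
- split.
  + by move=> x _; case: (dG x).
  + exact/cvg_at_right_filter/cG.
  + exact/cvg_at_left_filter/cG.
- by move=> x _; rewrite derive1E; case: (dG x).
Qed.

End perturbation.

(** * Risk at a density and at its perturbation *)

Section perturbed_density.
Context {R : realType} {X : set R}.
Let mu := @lebesgue_measure R.
Implicit Types (f : density X) (g : R -> R).

Lemma perturbed_density f g :
  mu.-integrable setT (EFin \o g) -> (\int[mu]_x (g x)%:E = 0)%E ->
  (forall x, 0 <= f x + g x) -> (forall x, ~ X x -> g x = 0) ->
  exists f1 : density X, forall x, f1 x = f x + g x.
Proof.
move=> ig g0 fg0 gX.
have mg : measurable_fun setT g by apply/measurable_EFinP; exact: measurable_int ig.
have mfg : measurable_fun setT (fun x => f x + g x).
  by apply: measurable_funD => //; exact: measurable_pdf.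
have offX x : ~ X x -> f x + g x = 0 by move=> Xx; rewrite pdf_off// gX// addr0.
have fg1 : (\int[mu]_x (f x + g x)%:E = 1)%E.
  under eq_integral do rewrite EFinD.
  rewrite integralD//; last exact: integrable_pdf.
  by rewrite g0 adde0 integral_pdf.
by exists (Density mfg fg0 offX fg1).
Qed.

(** The ratio (f + g) / f, with value one where f and g both vanish. *)
Definition perturbation_ratio f g (x : R) : R := 1 + g x / f x.

Lemma perturbation_likelihood_ratio (f f1 : density X) g (w : R) :
  measurable_fun setT g -> (forall x, f1 x = f x + g x) ->
  0 < w -> (forall x, g x != 0 -> w <= f x) ->
  likelihood_ratio (density_prob f) (density_prob f1) (perturbation_ratio f g).
Proof.
move=> mg f1E w0 gw.
have fP x : g x = 0 \/ 0 < f x.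
  by have [->|/gw/(lt_le_trans w0)] := eqVneq (g x) 0; [left|right].
apply: density_likelihood_ratio.
- apply: measurable_funD => //; apply: measurable_funM => //.
  rewrite (_ : (fun _ => _) = (fun x => f x `^ (-1))).
    exact: (measurableT_comp (measurable_powR _) (measurable_pdf f)).
  by apply/funext => x; rewrite powR_inv1// pdf_ge0.
- move=> x; rewrite /perturbation_ratio.
  have [->|fx] := fP x; first by rewrite mul0r addr0.
  rewrite -(mulfV (lt0r_neq0 fx)) -mulrDl divr_ge0 ?pdf_ge0//.
  by rewrite -f1E pdf_ge0.
- move=> x; rewrite f1E /perturbation_ratio.
  have [->|fx] := fP x; first by rewrite mul0r !addr0 mul1r.
  by rewrite mulrDl mul1r divfK// lt0r_neq0.
Qed.

(** The mean of 1 + g/f under f + g is the integral of f + 2g + g^2/f, that is one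
    plus the chi-square divergence, and g^2/f is at most (b/w) |g|. *)
Lemma perturbation_second_moment (f f1 : density X) g (w b h x0 : R) :
  (forall x, f1 x = f x + g x) ->
  0 < w -> (forall x, g x != 0 -> w <= f x) ->
  0 <= b -> 0 < h -> continuous g -> (forall x, `|g x| <= b) ->
  (forall x, h < `|x - x0| -> g x = 0) -> (\int[mu]_x (g x)%:E = 0)%E ->
  (\int[density_prob f1]_x (perturbation_ratio f g x)%:E
   <= (1 + b / w * (b * (2 * h)))%:E)%E.
Proof.
move=> f1E w0 gw b0 h0 cg gb gs g0.
have mg : measurable_fun setT g by exact: continuous_measurable_fun.
have [ml l0 _] := perturbation_likelihood_ratio mg f1E w0 gw.
have ig := integrable_supported b0 h0 cg gb gs.
have ifn := integrable_pdf f.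
have ian : mu.-integrable setT (fun x => `|g x|%:E).
  exact: (integrable_norm ig).
have mlE : measurable_fun setT (EFin \o perturbation_ratio f g).
  exact/measurable_EFinP.
rewrite integral_density_prob//.
pose u x : \bar R := ((f x)%:E + (2%:E * (g x)%:E + (b / w)%:E * `|g x|%:E))%E.
apply: (@le_trans _ _ (\int[mu]_x u x)%E).
  apply: ge0_le_integral => //.
  - by move=> x _; rewrite -EFinM lee_fin mulr_ge0// pdf_ge0.
  - apply: emeasurable_funM => //; apply/measurable_EFinP; exact: measurable_pdf.
  - apply: emeasurable_funD; first exact: measurable_int ifn.
    apply: emeasurable_funD; apply: measurable_funeM.
      exact: measurable_int ig.
    exact: measurable_int ian.
  - move=> x _; rewrite /u -!EFinM -!EFinD lee_fin f1E /perturbation_ratio.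
    have [->|gx0] := eqVneq (g x) 0; first by rewrite normr0 !(mul0r, mulr0, addr0) mul1r.
    have fx := lt_le_trans w0 (gw _ gx0).
    rewrite [leLHS](_ : _ = f x + (2 * g x + g x ^+ 2 / f x)); last first.
      by field; rewrite lt0r_neq0.
    rewrite !lerD2l -[g x ^+ 2]real_normK ?num_real// expr2 mulrAC.
    rewrite ler_wpM2r// ler_pM// ?invr_ge0 ?(ltW fx)// lef_pV2 ?posrE// gw//.
have i2 : mu.-integrable setT (fun x => 2%:E * (g x)%:E)%E by exact: integrableZl.
have ib : mu.-integrable setT (fun x => (b / w)%:E * `|g x|%:E)%E.
  exact: integrableZl.
rewrite /u integralD//; last exact: integrableD.
rewrite integralD// !integralZl// g0 mule0 add0e integral_pdf [leRHS]EFinD leeD2l//.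
rewrite [leRHS]EFinM lee_wpmul2l ?lee_fin ?divr_ge0 ?(ltW w0)//.
exact: (integral_supported_le b0 h0 cg gb gs).
Qed.

Lemma pow1D_le2 (z : R) n : 0 <= z -> n%:R * z <= 2^-1 -> (1 + z) ^+ n <= 2.
Proof.
move=> z0 nz.
have /le_trans : (1 + z) ^+ n <= expR z ^+ n.
  by rewrite lerXn2r ?nnegrE ?expR_ge0 ?addr_ge0// expR_ge1Dx.
apply; rewrite -expRM_natl; apply: (@le_trans _ _ (expR 2^-1)); first by rewrite ler_expR.
have : 2^-1 <= expR (- 2^-1) :> R by rewrite (le_trans _ (expR_ge1Dx _))//; lra.
by rewrite expRN lef_pV2 ?posrE ?expR_gt0.
Qed.

(** The second moment of the likelihood ratio of n observations is the n-th power
    of that of one observation, hence at most exp (1/2) <= 2 when n times the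
    chi-square divergence is at most 1/2. *)
Lemma perturbation_risk (f f1 : density X) g (w b h x0 : R) n (U : n.-tuple R -> R) :
  (forall x, f1 x = f x + g x) ->
  0 < w -> (forall x, g x != 0 -> w <= f x) ->
  0 <= b -> 0 < h -> continuous g -> (forall x, `|g x| <= b) ->
  (forall x, h < `|x - x0| -> g x = 0) -> (\int[mu]_x (g x)%:E = 0)%E ->
  n%:R * (b / w * (b * (2 * h))) <= 2^-1 ->
  measurable_fun setT U ->
  ((3^-1 * (g x0) ^+ 2)%:E <=
   expect_iid f (fun t => `|U t - f x0| ^+ 2)%R
   + expect_iid f1 (fun t => `|U t - f1 x0| ^+ 2)%R)%E.
Proof.
move=> f1E w0 gw b0 h0 cg gb gs g0 nb mU.
have mg : measurable_fun setT g by exact: continuous_measurable_fun.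
have lr := perturbation_likelihood_ratio mg f1E w0 gw.
have [ml l0 _] := lr.
have l2 := perturbation_second_moment f1E w0 gw b0 h0 cg gb gs g0.
have -> : g x0 = f1 x0 - f x0 by rewrite f1E addrAC subrr add0r.
rewrite /expect_iid unlock.
under eq_integral do rewrite real_normK ?num_real//.
under [X in (_ + X)%E]eq_integral do rewrite real_normK ?num_real//.
apply: (@two_point_risk _ _ _ _ _ _ U (f x0) (f1 x0) (iid_likelihood_ratio n lr)) => //.
rewrite integral_iid_likelihood//.
set I := (\int[_]_x _)%E in l2 *.
have I0 : (0 <= I)%E by apply: integral_ge0 => x _; rewrite lee_fin.
set z := b / w * _ in l2 nb.
have z0 : 0 <= z by rewrite mulr_ge0// ?divr_ge0 ?(ltW w0)// !mulr_ge0// ltW.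
move: I I0 l2 => [i| |]//; rewrite ?lee_fin => i0 iz.
rewrite -EFin_expe lee_fin (le_trans _ (pow1D_le2 z0 nb))//.
by rewrite lerXn2r ?nnegrE// addr_ge0.
Qed.

End perturbed_density.

(** * The perturbation lies in the neighbourhood *)

Section scaled_bump.
Context {R : realType}.
Let mu := @lebesgue_measure R.

(** With height a h^s, the s-th derivative is of size a whatever the width h. *)
Definition scaled_bump (phi : R -> R) (s : nat) (a h x0 x : R) : R :=
  a * h ^+ s * phi ((x - x0) / h).

Lemma scaled_bump_outside phi s (a h x0 x : R) : 0 < h ->
  (forall u, 1 <= `|u| -> phi u = 0) -> h <= `|x - x0| ->
  scaled_bump phi s a h x0 x = 0.
Proof.
move=> h0 phi0 hx; rewrite /scaled_bump phi0 ?mulr0//.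
by rewrite normrM normfV (gtr0_norm h0) ler_pdivlMr// mul1r.
Qed.

Lemma scaled_bump_derivatives phi s (a h x0 B : R) :
  perturbation_profile s B phi -> 0 <= a -> 0 < h -> h <= 1 ->
  let g := scaled_bump phi s a h x0 in
  forall k, (k <= s)%N ->
    [/\ continuous (derive1n k g), forall x, `|derive1n k g x| <= a * B
      & forall x, h < `|x - x0| -> derive1n k g x = 0].
Proof.
move=> [_ phi0 _ nphi phiB] a0 h0 h1 g k ks.
have [_ gE] := derive1n_scale (a * h ^+ s) x0 h nphi ks.
have [cphi Bphi] := phiB k ks.
have oV : open [set x : R | h < `|x - x0|].
  apply: (@open_comp _ _ (fun x : R => `|x - x0|) [set y | h < y]); last exact: open_gt.
  by move=> x _; apply: cvg_norm; apply: cvgB; [exact: cvg_id|exact: cvg_cst].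
have gV : {in [set x : R | h < `|x - x0|], g =1 cst 0}.
  by move=> x; rewrite inE/= => /ltW hx; exact: scaled_bump_outside.
split.
- rewrite -[g]/(fun x => a * h ^+ s * phi ((x - x0) / h)) gE => x.
  apply: cvgM; first exact: cvg_cst.
  apply: (@cvg_comp _ _ _ (fun x : R => (x - x0) / h) (derive1n k phi)); last exact: cphi.
  by apply: cvgM; [apply: cvgB; [exact: cvg_id|exact: cvg_cst]|exact: cvg_cst].
- move=> x; rewrite -[g]/(fun x => a * h ^+ s * phi ((x - x0) / h)) gE.
  rewrite normrM ler_pM// -mulrA normrM (ger0_norm a0) ler_piMr//.
  rewrite -(subnK ks) exprD -mulrA -exprMn mulfV ?lt0r_neq0// expr1n mulr1.
  by rewrite ger0_norm ?exprn_ge0 ?(ltW h0)// exprn_ile1// ltW.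
- move=> x hx; have [+ _] := derive1n_eq_open k oV gV.
  by move=> /(_ x); rewrite inE/= => /(_ hx) ->; rewrite derive1n_cst0.
Qed.

(** As h <= 1, the derivatives of order k <= s of the perturbation are at most aB
    and live on an interval of length 2h, hence have norm at most 2haB in L^1. *)
Lemma scaled_bump_neighbourhood (X : set R) (f0 f1 : density X) phi s
    (a h x0 B rho M delta eps : R) :
  perturbation_profile s B phi ->
  0 <= a -> 0 < h -> h <= 1 -> h < rho ->
  (forall x, `|x - x0| < rho -> nderivable s f0 x) ->
  (forall x, f1 x = f0 x + scaled_bump phi s a h x0 x) ->
  a * B <= M * `|derive1n s f0 x0| -> a * B * (2 * h) <= delta ->
  neighbourhood s f0 x0 M delta eps f1.
Proof.
move=> pphi a0 h0 h1 hrho nf f1E aBM aBd; have [_ phi0 _ nphi _] := pphi.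
set g := scaled_bump phi s a h x0.
have f1g : f1 = f0 \+ g :> (R -> R) by apply/funext => x; exact: f1E.
have dg := scaled_bump_derivatives x0 pphi a0 h0 h1.
have aB0 : 0 <= a * B.
  by have [_ /(_ x0) + _] := dg 0%N isT; exact: le_trans.
have ng x : nderivable s g x.
  by have [+ _] := derive1n_scale (a * h ^+ s) x0 h nphi (leqnn s); apply.
have cd : continuous (fun x : R => `|x - x0|).
  by move=> x; apply: cvg_norm; apply: cvgB; [exact: cvg_id|exact: cvg_cst].
have oU : open [set x : R | `|x - x0| < rho].
  by apply: (@open_comp _ _ _ [set y | y < rho]) => [x _|]; [exact: cd|exact: open_lt].
have oV : open [set x : R | h < `|x - x0|].
  by apply: (@open_comp _ _ _ [set y | h < y]) => [x _|]; [exact: cd|exact: open_gt].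
have UV : [set x : R | `|x - x0| < rho] `|` [set x : R | h < `|x - x0|] = setT.
  rewrite -subTset => x _ /=; have [xr|xr] := ltP `|x - x0| rho; [by left|right].
  exact: lt_le_trans xr.
have gV x : [set x : R | h < `|x - x0|] x -> g x = 0.
  by move=> /= /ltW; exact: scaled_bump_outside.
have pert := derive1n_perturb oU oV UV nf ng gV.
have rho0 : 0 < rho by exact: lt_trans hrho.
split.
  have [nfg fgE] := pert s (leqnn s) x0.
  rewrite /smooth_densities /= f1g; split.
    by apply: nfg; apply: nf; rewrite subrr normr0.
  rewrite fgE (le_trans (ler_normD _ _))// mulrDl mul1r lerD2l.
  have [_ /(_ x0) + _] := dg s (leqnn s).
  by move=> /le_trans; apply.
move=> k ks; have [cg gB gs] := dg k ks.
have dE x : derive1n k f1 x - derive1n k f0 x = derive1n k g x.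
  by rewrite f1g (pert k ks x).2 addrAC subrr add0r.
have ik : mu.-integrable setT (EFin \o derive1n k g).
  exact: (integrable_supported aB0 h0 cg gB gs).
have mI : measurable ([set x : R | `|x - x0| <= eps] : set (measurableTypeR R)).
  rewrite (_ : [set _ | _] = `[x0 - eps, x0 + eps]%classic).
    exact: measurable_itv.
  by apply/seteqP; split => x /=; rewrite in_itv/= -ler_distlC distrC.
split.
- apply: aeW => x _; rewrite f1g; exact: (pert k ks x).1.
- rewrite (_ : (fun _ => _) = EFin \o derive1n k g); last first.
    by apply/funext => x; rewrite /= dE.
  exact: (integrableS measurableT).
- under eq_integral do rewrite dE.
  apply: (@le_trans _ _ (\int[mu]_x `|derive1n k g x|%:E)%E).
    apply: ge0_subset_integral => //.
    apply/measurable_EFinP; apply: measurableT_comp => //.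
    exact: continuous_measurable_fun.
  apply: le_trans (integral_supported_le aB0 h0 cg gB gs) _.
  by rewrite lee_fin.
Qed.

End scaled_bump.

(** * Bandwidth and rate of convergence *)

Section rate.
Context {R : realType}.

Lemma near_natr_powRN_le (e eta : R) : 0 < e -> 0 < eta ->
  \forall n \near \oo, (n%:R : R) `^ (- e) <= eta.
Proof.
move=> e0 eta0; near=> n.
have n0 : (0 : R) < n%:R by rewrite ltr0n; near: n; exact: nbhs_infty_gt.
rewrite powRN -[leRHS]invrK lef_pV2 ?posrE ?powR_gt0 ?invr_gt0//.
have -> : eta^-1 = (eta^-1 `^ e^-1) `^ e.
  by rewrite -powRrM mulVf ?lt0r_neq0// powRr1// invr_ge0 ltW.
apply: ge0_ler_powR; rewrite ?nnegrE ?powR_ge0 ?(ltW e0) ?(ltW n0)//.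
by near: n; exact: nbhs_infty_ger.
Unshelve. all: by end_near. Qed.

Lemma limn_einf_ge (u : (\bar R)^nat) (c : \bar R) :
  (\forall n \near \oo, c <= u n)%E -> (c <= limn_einf u)%E.
Proof.
move=> [N _ cu]; rewrite limn_einf_lim.
rewrite (cvg_lim _ (@cvg_einfs_sup _ u))//.
apply: le_trans (ereal_sup_ubound _); last by exists N.
by apply: le_ereal_inf_tmp => _ [n /= Nn <-]; exact: cu.
Qed.

(** The width h that solves n h^(2s+1) = c, at which n times the chi-square
    divergence, of order n h^(2s+1), stays constant. *)
Definition bandwidth (s : nat) (c : R) (n : nat) : R :=
  (c / n%:R) `^ (2 * s + 1)%:R^-1.

Lemma bandwidth_gt0 s c n : 0 < c -> (0 < n)%N -> 0 < bandwidth s c n.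
Proof. by move=> c0 n0; rewrite powR_gt0// divr_gt0// ltr0n. Qed.

Lemma bandwidthE s c n : 0 < c ->
  bandwidth s c n = c `^ (2 * s + 1)%:R^-1 * n%:R `^ (- (2 * s + 1)%:R^-1).
Proof.
move=> c0; rewrite /bandwidth powRM ?invr_ge0 ?ler0n ?(ltW c0)//; congr (_ * _).
by rewrite -powR_inv1// -powRrM mulN1r.
Qed.

Lemma bandwidthX s c n k : 0 < c ->
  bandwidth s c n ^+ k = (c / n%:R) `^ (k%:R / (2 * s + 1)%:R).
Proof.
by move=> c0; rewrite /bandwidth -powR_mulrn ?powR_ge0// -powRrM (mulrC _ k%:R).
Qed.

Lemma bandwidth_full s c n : 0 < c -> bandwidth s c n ^+ (2 * s + 1) = c / n%:R.
Proof.
move=> c0; rewrite bandwidthX// mulfV ?pnatr_eq0 ?addn1// powRr1//.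
by rewrite divr_ge0// ltW.
Qed.

(** Here B bounds the profile and its derivatives up to order s; the factor 1/6 is
    1/3 from the two-point inequality, halved as the larger of two risks is at
    least their mean. *)
Definition minimax_constant (B M : R) (s : nat) : R :=
  6^-1 * (M / B) ^+ 2 * (8 * M ^+ 2) `^ (- ((2 * s)%:R / (2 * s + 1)%:R)).

Lemma minimax_constant_gt0 (B M : R) (s : nat) :
  0 < B -> 0 < M -> 0 < minimax_constant B M s.
Proof.
move=> B0 M0; rewrite mulr_gt0//; last by rewrite powR_gt0// mulr_gt0// exprn_gt0.
by rewrite mulr_gt0// exprn_gt0// divr_gt0.
Qed.

(** The amplitude MD/B uses up the allowance M D for the s-th derivative, and the
    bandwidth makes n times the chi-square divergence at most 1/2; the powers of n
    then cancel. *)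
Lemma minimax_rate (s n : nat) (B M v D : R) :
  0 < B -> 0 < M -> 0 < v -> 0 < D -> (0 < n)%N ->
  n%:R `^ ((2 * s)%:R / (2 * s + 1)%:R)
    * (6^-1 * (M * D / B * bandwidth s (v / (8 * (M * D) ^+ 2)) n ^+ s) ^+ 2)
  = minimax_constant B M s * v `^ ((2 * s)%:R / (2 * s + 1)%:R)
    * D `^ (2 / (2 * s + 1)%:R).
Proof.
move=> B0 M0 v0 D0 n0; set p := (2 * s)%:R / (2 * s + 1)%:R.
have n0' : (0 : R) < n%:R by rewrite ltr0n.
have MD0 : 0 < 8 * (M * D) ^+ 2 by rewrite mulr_gt0// exprn_gt0// mulr_gt0.
have c0 : 0 < v / (8 * (M * D) ^+ 2) by rewrite divr_gt0.
have M8 : 0 < 8 * M ^+ 2 by rewrite mulr_gt0// exprn_gt0.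
have hE : bandwidth s (v / (8 * (M * D) ^+ 2)) n ^+ s ^+ 2
    = v `^ p * (8 * M ^+ 2) `^ (- p) * D `^ (- p * 2) * n%:R `^ (- p).
  rewrite -exprM mulnC bandwidthX// -/p.
  have -> : v / (8 * (M * D) ^+ 2) / n%:R
      = v * (8 * M ^+ 2) `^ (-1) * D `^ (- 2) * n%:R `^ (-1).
    rewrite !powR_inv1 ?(ltW M8) ?(ltW n0')// powRN powR_mulrn ?(ltW D0)//.
    by field; rewrite !lt0r_neq0.
  have powRM4 (w x y z : R) : 0 <= w -> 0 <= x -> 0 <= y -> 0 <= z ->
      (w * x * y * z) `^ p = w `^ p * x `^ p * y `^ p * z `^ p.
    by move=> *; rewrite !powRM ?mulr_ge0.
  rewrite powRM4 ?powR_ge0 ?(ltW v0)// -!powRrM !mulN1r.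
  by rewrite (mulNr 2) (mulNr p 2) (mulrC 2 p).
have DE : D `^ (2 / (2 * s + 1)%:R) = D ^+ 2 * D `^ (- p * 2).
  rewrite -powR_mulrn ?(ltW D0)// -powRD ?lt0r_neq0 ?implybT//; congr (_ `^ _).
  rewrite /p natrM natrD; field.
  by rewrite lt0r_neq0// ltr_wpDl// mulr_ge0.
have np : n%:R `^ p * n%:R `^ (- p) = 1 :> R.
  by rewrite -powRD ?subrr ?powRr0// lt0r_neq0 ?implybT.
rewrite exprMn hE DE /minimax_constant -/p.
transitivity (6^-1 * (M * D / B) ^+ 2
  * (v `^ p * (8 * M ^+ 2) `^ (- p) * D `^ (- p * 2)) * (n%:R `^ p * n%:R `^ (- p))).
  by ring.
by rewrite np; field; rewrite lt0r_neq0.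
Qed.

Lemma minimax_risk_ge (X : set R) (s n : nat) (f0 f1 : density X)
    (x0 M delta eps c : R) (U : n.-tuple R -> R) :
  neighbourhood s f0 x0 M delta eps f0 ->
  neighbourhood s f0 x0 M delta eps f1 ->
  let N := n%:R `^ ((2 * s)%:R / (2 * s + 1)%:R) in
  (c%:E <= expect_iid f0 (fun t => `|U t - f0 x0| ^+ 2)%R
   + expect_iid f1 (fun t => `|U t - f1 x0| ^+ 2)%R)%E ->
  ((N * (2^-1 * c))%:E <= ereal_sup
     [set N%:E * expect_iid f (fun t => `|U t - f x0| ^+ 2)%R
     | f in neighbourhood s f0 x0 M delta eps])%E.
Proof.
move=> nb0 nb1 N cle; set S := ereal_sup _.
pose r (f : density X) := expect_iid f (fun t => `|U t - f x0| ^+ 2)%R.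
have r0 f : (0 <= r f)%E.
  by rewrite /r /expect_iid unlock; apply: integral_ge0 => t _; rewrite lee_fin exprn_ge0.
have N0 : 0 <= N by exact: powR_ge0.
have rS f : neighbourhood s f0 x0 M delta eps f -> (N%:E * r f <= S)%E.
  by move=> nf; apply: ereal_sup_ubound; exists f.
have NS : ((N * c)%:E <= S + S)%E.
  apply: le_trans (leeD (rS _ nb0) (rS _ nb1)).
  by rewrite -ge0_muleDr// EFinM lee_wpmul2l// lee_fin.
have S0 : (0 <= S)%E by apply: le_trans (rS _ nb0); rewrite mule_ge0// lee_fin.
move: S S0 NS {rS} => [x| |]//; rewrite ?lee_fin => x0' NS; last by rewrite leey.
by lra.
Qed.
End rate.

(** * The alternative density *)

Section two_point_construction.
Context {R : realType}.
Let mu := @lebesgue_measure R.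

Lemma integral_scaled_bump phi s (a h x0 B : R) :
  perturbation_profile s B phi -> 0 < h ->
  continuous (scaled_bump phi s a h x0) ->
  (\int[mu]_x (scaled_bump phi s a h x0 x)%:E = 0)%E.
Proof.
move=> [_ phi0 [Phi dPhi Phi1] _ _] h0 cg.
pose G x := a * h ^+ s * h * Phi ((x - x0) / h).
apply: (@integral_supported_derivative _ _ G x0 h) => //.
- by move=> x /ltW; exact: scaled_bump_outside.
- move=> x.
  have nPhi y : nderivable 1 Phi y.
    by split; [near=> z|case: (dPhi y)].
  have [dG GE] := derive1n_scale (a * h ^+ s * h) x0 h nPhi (leqnn 1).
  apply: DeriveDef; first by have [] := dG x.
  rewrite -derive1E -[G^`()%classic]/(derive1n 1 G) GE /= derive1E.
  have [_ ->] := dPhi ((x - x0) / h).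
  by rewrite /scaled_bump expr1 mulfK ?lt0r_neq0.
- rewrite /G addrAC subrr add0r divff ?lt0r_neq0//.
  by rewrite addrAC subrr add0r mulNr divff ?lt0r_neq0// Phi1.
Unshelve. all: by end_near. Qed.

(** Within rho of x0 the density f0 is at least v/2, so a perturbation of height
    at most v/2 supported there keeps it nonnegative, and null off X; integral zero
    keeps it of mass one. *)
Lemma exists_alternative (X : set R) (f0 : density X) phi s
    (a h x0 B rho v M delta eps : R) :
  perturbation_profile s B phi ->
  0 <= a -> 0 < h -> h <= 1 -> h < rho -> 0 < v ->
  (forall x, `|x - x0| < rho -> nderivable s f0 x /\ v / 2 <= f0 x) ->
  a * B <= M * `|derive1n s f0 x0| -> a * B * (2 * h) <= delta ->
  a * B * h ^+ s <= v / 2 ->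
  exists2 f1, neighbourhood s f0 x0 M delta eps f1 &
    forall n (U : n.-tuple R -> R), measurable_fun setT U ->
      4 * n%:R * (a * B) ^+ 2 * h ^+ (2 * s + 1) <= v / 2 ->
      ((3^-1 * (a * h ^+ s) ^+ 2)%:E <=
       expect_iid f0 (fun t => `|U t - f0 x0| ^+ 2)%R
       + expect_iid f1 (fun t => `|U t - f1 x0| ^+ 2)%R)%E.
Proof.
move=> pphi a0 h0 h1 hrho v0 near0 aBM aBd aBv.
have [phi1 phi0 _ _ phiB] := pphi.
set g := scaled_bump phi s a h x0.
have [cg _ gs] := scaled_bump_derivatives x0 pphi a0 h0 h1 (leq0n s).
have [_ Bphi] := phiB 0%N (leq0n s).
have B0 : 0 <= B by exact: le_trans (Bphi 0).
have hs0 : 0 <= h ^+ s by rewrite exprn_ge0// ltW.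
have gb x : `|g x| <= a * B * h ^+ s.
  rewrite /g /scaled_bump normrM ger0_norm ?mulr_ge0// [leRHS]mulrAC.
  by rewrite ler_wpM2l ?mulr_ge0//; exact: Bphi.
have b0 : 0 <= a * B * h ^+ s by rewrite !mulr_ge0.
have g0 := integral_scaled_bump pphi h0 cg.
have gw x : g x != 0 -> v / 2 <= f0 x.
  move=> gx; have [xh|hx] := ltP `|x - x0| h.
    by apply: (near0 x _).2; exact: lt_trans hrho.
  by move: gx; rewrite /g scaled_bump_outside ?eqxx.
have fg0 x : 0 <= f0 x + g x.
  have [->|gx] := eqVneq (g x) 0; first by rewrite addr0 pdf_ge0.
  rewrite -lerBlDr sub0r (le_trans (ler_norm _))// normrN.
  by rewrite (le_trans (gb x))// (le_trans aBv)// gw.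
have gX x : ~ X x -> g x = 0.
  move=> Xx; apply/eqP; apply: contra_notT Xx => /gw fx.
  apply: contrapT => /(pdf_off f0) fx0; move: fx; rewrite fx0.
  by rewrite leNgt divr_gt0.
have ig := integrable_supported b0 h0 cg gb gs.
have [f1 f1E] := perturbed_density ig g0 fg0 gX.
exists f1.
  have nf x : `|x - x0| < rho -> nderivable s f0 x by move=> /near0[].
  exact: (scaled_bump_neighbourhood eps pphi a0 h0 h1 hrho nf f1E aBM aBd).
move=> n U mU hn.
have -> : a * h ^+ s = g x0 by rewrite /g /scaled_bump subrr mul0r phi1 mulr1.
apply: (perturbation_risk f1E _ gw b0 h0 cg gb gs g0) => //; first by rewrite divr_gt0.
rewrite -(ler_pM2r (divr_gt0 v0 (ltr0Sn R 1))).
have hE : h ^+ (2 * s + 1) = h * h ^+ s ^+ 2 by rewrite addn1 exprS mulnC exprM.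
rewrite [leLHS](_ : _ = 2^-1 * (4 * n%:R * (a * B) ^+ 2 * h ^+ (2 * s + 1))).
  by rewrite ler_wpM2l.
by rewrite hE; field; rewrite lt0r_neq0.
Qed.

Lemma neighbourhood_self (X : set R) (f0 : density X) s (x0 M delta eps : R) :
  0 <= M -> 0 <= delta -> nderivable s f0 x0 ->
  neighbourhood s f0 x0 M delta eps f0.
Proof.
move=> M0 d0 nf; split; first by split => //; rewrite mulrDl mul1r lerDl mulr_ge0.
move=> k ks; split; first exact: aeW.
- rewrite (_ : (fun _ => _) = cst 0%E); first exact: integrable0.
  by apply/funext => x; rewrite subrr.
- under eq_integral do rewrite subrr normr0.
  by rewrite integral0 lee_fin.
Qed.

Lemma density_near (X : set R) (f0 : density X) s (x0 : R) : (1 <= s)%N ->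
  ncontinuously_derivable s f0 x0 -> 0 < f0 x0 ->
  exists2 rho, 0 < rho &
    forall x, `|x - x0| < rho -> nderivable s f0 x /\ f0 x0 / 2 <= f0 x.
Proof.
move=> s1 [nf _] v0.
have df : derivable f0 x0 1 := nderivable_derivable s1 (nbhs_singleton nf).
have cf : {for x0, continuous f0}.
  exact/differentiable_continuous/derivable1_diffP.
have nv : \forall y \near x0, f0 x0 / 2 <= f0 y.
  apply: (cvgr_ge _ cf); lra.
have [rho /= rho0 H] := (nbhs_ballP _ _).1 (filterI nf nv).
by exists rho => // x xr; apply: H; rewrite /ball/= distrC.
Qed.

End two_point_construction.

(** * The lower bound *)

Section local_lower_bound.
Context {R : realType}.

(** The bandwidth is a multiple of n^(-1/(2s+1)), which tends to zero, and does so
    faster than the radius c0 n^(-r) because r < 1/(2s+1). *)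
Lemma near_bandwidth (s : nat) (c rho m v M c0 r : R) :
  (1 <= s)%N -> 0 < c -> 0 < rho -> 0 < v -> 0 < m -> 0 < c0 ->
  r < (2 * s + 1)%:R^-1 ->
  \forall n \near \oo,
    [/\ (0 < n)%N, bandwidth s c n <= 1, bandwidth s c n < rho,
        m * bandwidth s c n ^+ s <= v
      & m * (2 * bandwidth s c n) <= c0 * n%:R `^ (- r)].
Proof.
move=> s1 c_0 rho0 v0 m0 c00 rq; set q : R := (2 * s + 1)%:R^-1.
have q0 : 0 < q by rewrite invr_gt0 ltr0n addn1.
have w0 : 0 < c `^ q by rewrite powR_gt0.
have small z : 0 < z -> \forall n \near \oo, bandwidth s c n <= z.
  move=> z0; near=> n.
  rewrite bandwidthE// -ler_pdivlMl// mulrC.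
  by near: n; apply: near_natr_powRN_le => //; rewrite divr_gt0.
near=> n.
have n0 : (0 < n)%N by near: n; exact: nbhs_infty_gt.
have h0 : 0 < bandwidth s c n by exact: bandwidth_gt0.
have h1 : bandwidth s c n <= 1 by near: n; exact: small.
split => //.
- apply: (@le_lt_trans _ _ (rho / 2)); last lra.
  by near: n; apply: small; rewrite divr_gt0.
- have : m * bandwidth s c n <= v.
    rewrite -ler_pdivlMl// mulrC; near: n; apply: small; rewrite divr_gt0//.
  apply: le_trans; rewrite ler_wpM2l ?(ltW m0)//.
  by rewrite -[leRHS]expr1 ler_wiXn2l// ltW.
- rewrite bandwidthE// -/q.
  rewrite (_ : - q = - (q - r) + - r); last by ring.
  rewrite powRD; last by rewrite pnatr_eq0 -lt0n n0 implybT.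
  rewrite !mulrA ler_wpM2r ?powR_ge0// -ler_pdivlMl ?mulr_gt0//.
  near: n; apply: near_natr_powRN_le; first by rewrite subr_gt0.
  by rewrite mulr_gt0// invr_gt0 !mulr_gt0.
Unshelve. all: by end_near. Qed.

(** When f0(x0) or the s-th derivative vanishes the bound is zero, and f0 itself
    belongs to the neighbourhood.  Otherwise the two hypotheses are f0 and its
    perturbation, for every n large enough. *)
Lemma local_minimax_bound (X : set R) (s : nat) (x0 M B : R) (f0 : density X)
    (phi : R -> R) (c0 r eps : R) :
  (1 <= s)%N -> 0 < M -> 0 < B -> perturbation_profile s B phi ->
  ncontinuously_derivable s f0 x0 ->
  0 < c0 -> r < (2 * s + 1)%:R^-1 ->
  (\forall n \near \oo, forall U : n.-tuple R -> R, measurable_fun setT U ->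
    (minimax_constant B M s * f0 x0 `^ ((2 * s)%:R / (2 * s + 1)%:R)
       * `|derive1n s f0 x0| `^ (2 / (2 * s + 1)%:R))%:E
    <= ereal_sup
         [set (n%:R `^ ((2 * s)%:R / (2 * s + 1)%:R))%:E
              * expect_iid f (fun t => `|U t - f x0| ^+ 2)%R
         | f in neighbourhood s f0 x0 M (c0 * n%:R `^ (- r)) eps])%E.
Proof.
move=> s1 M0 B0 pphi f0s c00 rq.
have nf0 : nderivable s f0 x0 by have [/nbhs_singleton] := f0s.
have nself n : neighbourhood s f0 x0 M (c0 * n%:R `^ (- r)) eps f0.
  by apply: neighbourhood_self => //; rewrite ?mulr_ge0 ?powR_ge0 ?(ltW M0) ?(ltW c00).
set p : R := (2 * s)%:R / (2 * s + 1)%:R.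
have p0 : p != 0.
  by rewrite mulf_neq0// ?invr_eq0 pnatr_eq0 ?addn1// muln_eq0/= -lt0n.
have sup_ge0 (c : R) : c = 0 ->
    \forall n \near \oo, forall U : n.-tuple R -> R, measurable_fun setT U ->
    (c%:E <= ereal_sup
       [set (n%:R `^ p)%:E * expect_iid f (fun t => `|U t - f x0| ^+ 2)%R
       | f in neighbourhood s f0 x0 M (c0 * n%:R `^ (- r)) eps])%E.
  move=> ->; near=> n => U mU.
  apply: le_trans (ereal_sup_ubound _); last by exists f0.
  rewrite mule_ge0 ?lee_fin ?powR_ge0// /expect_iid unlock.
  by apply: integral_ge0 => t _; rewrite lee_fin exprn_ge0.
have [v0|v0] := ltP 0 (f0 x0); last first.
  apply: sup_ge0; have -> : f0 x0 = 0 by apply/eqP; rewrite eq_le v0 pdf_ge0.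
  by rewrite powR0// mulr0 mul0r.
have [D0|D0] := eqVneq (derive1n s f0 x0) 0.
  by apply: sup_ge0; rewrite D0 normr0 powR0 ?mulr0// mulf_neq0//
    invr_eq0 pnatr_eq0 addn1.
set D := `|derive1n s f0 x0|.
have {}D0 : 0 < D by rewrite normr_gt0.
have [rho rho0 near0] := density_near s1 f0s v0.
set v := f0 x0 in v0 near0 *.
have MD0 : 0 < M * D by exact: mulr_gt0.
pose c := v / (8 * (M * D) ^+ 2).
have c_gt0 : 0 < c by rewrite divr_gt0// mulr_gt0// exprn_gt0.
near=> n => U mU.
have : [/\ (0 < n)%N, bandwidth s c n <= 1, bandwidth s c n < rho,
      M * D * bandwidth s c n ^+ s <= v / 2
    & M * D * (2 * bandwidth s c n) <= c0 * n%:R `^ (- r)].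
  by near: n; apply: near_bandwidth => //; rewrite divr_gt0.
move=> [n0 h1 hrho hv hd].
have aB : M * D / B * B = M * D by rewrite divfK// lt0r_neq0.
have a0 : 0 <= M * D / B by rewrite divr_ge0// ltW.
have h0 := bandwidth_gt0 s c_gt0 n0.
have [f1 nf1 risk] : exists2 f1,
    neighbourhood s f0 x0 M (c0 * n%:R `^ (- r)) eps f1 &
    forall n' (U : n'.-tuple R -> R), measurable_fun setT U ->
      4 * n'%:R * (M * D / B * B) ^+ 2 * bandwidth s c n ^+ (2 * s + 1) <= v / 2 ->
      ((3^-1 * (M * D / B * bandwidth s c n ^+ s) ^+ 2)%:E <=
       expect_iid f0 (fun t => `|U t - f0 x0| ^+ 2)%R
       + expect_iid f1 (fun t => `|U t - f1 x0| ^+ 2)%R)%E.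
  by apply: (exists_alternative eps pphi a0 h0 h1 hrho v0 near0) => //; rewrite aB.
have {}risk := risk n U mU.
have n0' : n%:R != 0 :> R by rewrite pnatr_eq0 -lt0n.
rewrite -(minimax_rate s B0 M0 v0 D0 n0).
have -> : 6^-1 * (M * D / B * bandwidth s (v / (8 * (M * D) ^+ 2)) n ^+ s) ^+ 2
    = 2^-1 * (3^-1 * (M * D / B * bandwidth s c n ^+ s) ^+ 2).
  by rewrite -/c; field; rewrite lt0r_neq0.
apply: (@minimax_risk_ge _ _ s n f0 f1) => //; apply: risk.
rewrite aB bandwidth_full// /c le_eqVlt; apply/orP; left; apply/eqP.
by field; rewrite n0' !lt0r_neq0.
Unshelve. all: by end_near. Qed.

End local_lower_bound.

Theorem lemma11 (R : realType) :
  exists C : nat -> R -> (R -> R) -> R,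
    (forall (s : nat) (M : R) (K : R -> R),
       (1 <= s)%N -> 0 < M -> kernels s K -> 0 < C s M K) /\
    forall (X : set R) (s : nat) (x0 M : R) (f0 : density X) (c0 r eps : R),
      (1 <= s)%N -> X x0 -> 0 < M ->
      ncontinuously_derivable s f0 x0 ->
      0 < c0 -> 0 <= r < (2 * s + 1)%:R^-1 -> 0 < eps ->
      (limn_einf (fun n : nat =>
         ereal_inf
           [set ereal_sup
                  [set (n%:R `^ ((2 * s)%:R / (2 * s + 1)%:R))%:E *
                       expect_iid f (fun t => `|T t - f x0| ^+ 2)%R
                  | f in neighbourhood s f0 x0 M (c0 * n%:R `^ (- r)) eps]
           | T in [set T : n.-tuple R -> R | measurable_fun setT T]])
       >= ereal_sup
            [set (C s M K * f0 x0 `^ ((2 * s)%:R / (2 * s + 1)%:R)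
                    * `|derive1n s f0 x0| `^ (2 / (2 * s + 1)%:R))%:E
            | K in kernels s])%E.
Proof.
have /choice[B HB] : forall s, exists B : R,
    1 <= B /\ exists phi, perturbation_profile s B phi.
  by move=> s; have [B B1 H] := @exists_perturbation_profile R s; exists B.
have B0 s : 0 < B s by apply: lt_le_trans (HB s).1.
exists (fun s M _ => minimax_constant (B s) M s); split.
  by move=> s M K _ M0 _; exact: minimax_constant_gt0.
move=> X s x0 M f0 c0 r eps s1 _ M0 f0s c00 /andP[_ rq] _.
apply: ge_ereal_sup => _ [K _ <-].
have [_ [phi pphi]] := HB s.
apply: limn_einf_ge.
have := local_minimax_bound eps s1 M0 (B0 s) pphi f0s c00 rq.
by apply: filterS => n H; apply: le_ereal_inf_tmp => _ [U mU <-]; exact: H.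
Qed.
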